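(* Let $F^m=(M,M',F)$ be a Finsler manifold, $HM'$ a nonlinear connection on $M'$ with associate almost complex structure $J$, and $G$ the Sasaki metric on $M'$. The almost Hermitian manifold $(M',J,G)$ is an almost Kähler manifold if and only if, in local coordinates and for all indices $i,j,k$, $$\frac{\delta g_{ik}}{\delta x^j}+\frac{\partial N^h_k}{\partial y^i}g_{hj}-\left(\frac{\delta g_{ij}}{\delta x^k}+\frac{\partial N^h_j}{\partial y^i}g_{hk}\right)=0$$ and $$R^h_{ij}g_{hk}-R^h_{ik}g_{hj}+R^h_{jk}g_{hi}=0,$$ where $R^k_{ij}=\frac{\delta N^k_i}{\delta x^j}-\frac{\delta N^k_j}{\delta x^i}$.
   Context: Let $M$ be a real $m$-dimensional smooth manifold, $\pi:TM\to M$ its tangent bundle with zero section $\theta$, and $M'\subset TM$ a nonempty open submanifold with $\pi(M')=M$ and $\theta(M)\cap M'=\varnothing$, with induced local coordinates $(x^i,y^i)$. A Finsler manifold $F^m=(M,M',F)$ is given by a positive smooth function $F$ on $M'$ such that $F^{\ast}=F^2$ satisfies $F^{\ast}(x,ky)=k^2F^{\ast}(x,y)$ for $k>0$ (whenever both sides are defined) and $g_{ij}=\frac12\frac{\partial^2F^{\ast}}{\partial y^i\partial y^j}$ is positive definite at each point. $VM'=\ker(\pi_{\ast}|_{TM'})$ is the vertical vector bundle, locally spanned by $\frac{\partial}{\partial y^i}$. A nonlinear connection is a distribution $HM'$ with $TM'=HM'\oplus VM'$; it is locally spanned by $\frac{\delta}{\delta x^i}=\frac{\partial}{\partial x^i}-N^j_i(x,y)\frac{\partial}{\partial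 y^j}$. The associate almost complex structure to $HM'$ is the bundle map $J:TM'\to TM'$ with $J(\frac{\delta}{\delta x^i})=-\frac{\partial}{\partial y^i}$, $J(\frac{\partial}{\partial y^i})=\frac{\delta}{\delta x^i}$. The Sasaki metric is $G=g_{ij}(x,y)dx^idx^j+g_{ij}(x,y)\delta y^i\delta y^j$ with $\delta y^i=dy^i+N^i_j(x,y)dx^j$; that is, $G(\frac{\delta}{\delta x^i},\frac{\delta}{\delta x^j})=G(\frac{\partial}{\partial y^i},\frac{\partial}{\partial y^j})=g_{ij}$ and $G(\frac{\delta}{\delta x^i},\frac{\partial}{\partial y^j})=0$. The pair $(J,G)$ is an almost Hermitian structure on $M'$. Its fundamental $2$-form is $\Phi(X,Y)=G(X,JY)$, and $(M',J,G)$ is almost Kähler if $d\Phi=0$. The summation convention is used. *)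

(* Defs.v *)
From HB Require Import structures.
From mathcomp Require Import all_boot all_order all_algebra.
From mathcomp Require Import all_classical all_reals all_analysis.

Set Implicit Arguments.
Unset Strict Implicit.
Unset Printing Implicit Defensive.

Import Order.TTheory GRing.Theory Num.Theory.
Import numFieldNormedType.Exports.

Local Open Scope classical_set_scope.
Local Open Scope ring_scope.

Section Smooth.
Context {R : realType} {V W : normedModType R}.

(* For finite-dimensional V and open U this is the usual class C^k on U:
   f is differentiable on U and all its directional derivatives are C^(k-1). *)
Fixpoint Ck (k : nat) (f : V -> W) (U : set V) : Prop :=
  match k with
  | 0 => forall x, U x -> {for x, continuous f}
  | k'.+1 => (forall x, U x -> differentiable f x) /\
             (forall v : V, Ck k' (fun x => 'D_v f x) U)
  end.

Definition smooth (f : V -> W) (U : set V) : Prop := forall k, Ck k f U.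

End Smooth.

(* Only the values of [mcoord c] on [dom c] matter. *)
Record atlas (R : realType) (n : nat) := Atlas {
  carrier :> Type;
  chart : Type;
  dom : chart -> set carrier;
  mcoord : chart -> carrier -> 'rV[R]_n }.

Section Manifold.
Context {R : realType} {n : nat} (A : atlas R n).
Implicit Types (c d : chart A) (p q : A) (U W : set A).

(* The expression of f in the chart c, that is f \o (mcoord c)^-1 on
   [mcoord c @` dom c]; the value outside this set is irrelevant. *)
Definition local_rep (S : normedModType R) c (f : A -> S) : 'rV[R]_n -> S :=
  fun x => xget 0 (f @` [set p | dom c p /\ mcoord c p = x]).

Definition mopen W : Prop := forall c, open (mcoord c @` (W `&` dom c)).

Definition smooth_on (S : normedModType R) W (f : A -> S) : Prop :=
  forall c, smooth (local_rep c f) (mcoord c @` (W `&` dom c)).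

Record smooth_manifold : Prop := {
  chart_cover : forall p, exists c, dom c p;
  chart_inj : forall c, set_inj (dom c) (mcoord c);
  chart_open : forall c d, open (mcoord c @` (dom c `&` dom d));
  chart_smooth : forall c d,
    smooth (local_rep c (mcoord d)) (mcoord c @` (dom c `&` dom d));
  manifold_hausdorff : forall p q, p <> q -> exists U W,
    [/\ mopen U, mopen W, U p, W q & U `&` W = set0];
  manifold_second_countable : exists B : nat -> set A,
    (forall k, mopen (B k)) /\
    (forall W p, mopen W -> W p -> exists k, B k p /\ B k `<=` W) }.

(* A tangent vector at p is the family of its components in all the charts
   around p, which transform by the differentials of the transition maps
   (and which are 0, by convention, in the other charts). *)
Definition tvector := chart A -> 'rV[R]_n.

Definition tangent_space p : set tvector := [set v |
  (forall c d, dom c p -> dom d p ->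
     v d = 'D_(v c) (local_rep c (mcoord d)) (mcoord c p)) /\
  (forall c, ~ dom c p -> v c = 0)].

(* The tangent vector at p whose components in the chart c are a. *)
Definition tvec c p (a : 'rV[R]_n) : tvector := fun d =>
  if `[< dom d p >] then 'D_a (local_rep c (mcoord d)) (mcoord c p) else 0.

Definition coord_vec c p (a : 'I_n) : tvector := tvec c p 'e_a.

Definition pderiv c (a : 'I_n) (f : A -> R) : A -> R :=
  fun p => 'D_('e_a) (local_rep c f : 'rV[R]_n -> R^o) (mcoord c p).

Definition smooth_vector_field U (X : A -> tvector) : Prop :=
  (forall p, U p -> tangent_space p (X p)) /\
  (forall c, smooth (local_rep c (fun p => X p c)) (mcoord c @` (U `&` dom c))).

Definition tspan r (e : 'I_r -> tvector) : set tvector :=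
  [set v | exists a : 'I_r -> R, v = \sum_i a i *: e i].

Definition tfree r (e : 'I_r -> tvector) : Prop :=
  forall a : 'I_r -> R, \sum_i a i *: e i = 0 -> forall i, a i = 0.

(* Smooth distribution of rank r on the open set W. *)
Definition distribution r W (H : A -> set tvector) : Prop :=
  forall p, W p -> exists U (X : 'I_r -> A -> tvector),
    [/\ mopen U, U p, U `<=` W,
        (forall i, smooth_vector_field U (X i)) &
        forall q, U q -> tfree (X^~ q) /\ H q = tspan (X^~ q)].

(* The components of the exterior derivative of the 2-form
   w = 1/2 w_ab dz^a /\ dz^b in the chart c with coordinates z:
   (dw)_abe = d_a w_be - d_b w_ae + d_e w_ab. *)
Definition form2 := A -> tvector -> tvector -> R.

Definition form2_comp (w : form2) c (a b : 'I_n) : A -> R :=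
  fun p => w p (coord_vec c p a) (coord_vec c p b).

Definition dform2_comp (w : form2) c (a b e : 'I_n) : A -> R := fun p =>
  pderiv c a (form2_comp w c b e) p - pderiv c b (form2_comp w c a e) p
  + pderiv c e (form2_comp w c a b) p.

Definition closed_form2 W (w : form2) : Prop :=
  forall c p, W p -> dom c p -> forall a b e, dform2_comp w c a b e p = 0.

End Manifold.

(* w is the image of v under the tangent map of f at p. *)
Definition tangent_map (R : realType) (n k : nat) (A : atlas R n)
    (B : atlas R k) (f : A -> B) (p : A) (v : tvector A) (w : tvector B) : Prop :=
  tangent_space (f p) w /\
  forall c d, dom c p -> dom d (f p) ->
    w d = 'D_(v c) (local_rep c (fun q => mcoord d (f q))) (mcoord c p).

Section TangentBundle.
Context {R : realType} {m : nat} (M : atlas R m).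

Definition tangent_point :=
  {pv : M * tvector M | tangent_space pv.1 pv.2}.

Definition tproj (u : tangent_point) : M := (sval u).1.
Definition tfiber (u : tangent_point) : tvector M := (sval u).2.

(* A chart (U, x) of M induces the chart (tproj^-1 U, (x, y)) of TM. *)
Definition tangent_bundle : atlas R (m + m) :=
  @Atlas R (m + m) tangent_point (chart M)
    (fun c => [set u | dom c (tproj u)])
    (fun c u => row_mx (mcoord c (tproj u)) (tfiber u c)).

Lemma tangent_space0 (p : M) : tangent_space p (0 : tvector M).
Proof. by split=> // c d _ _; rewrite derive0. Qed.

Definition zero_section (p : M) : tangent_bundle :=
  exist _ (p, 0 : tvector M) (tangent_space0 p).

End TangentBundle.

Section Finsler.
Context {R : realType} {m : nat} (M : atlas R m).
Notation TM := (tangent_bundle M).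
Implicit Types (F : TM -> R) (c : chart M) (u : TM).
Implicit Types (i j k h : 'I_m).

Definition dx c i (f : TM -> R) : TM -> R := @pderiv _ _ TM c (lshift m i) f.
Definition dy c i (f : TM -> R) : TM -> R := @pderiv _ _ TM c (rshift m i) f.

Definition vec_x c u i : tvector TM := @coord_vec _ _ TM c u (lshift m i).
Definition vec_y c u i : tvector TM := @coord_vec _ _ TM c u (rshift m i).

Definition fmetric F c i j : TM -> R :=
  fun u => 2^-1 * dy c i (dy c j (fun v => F v ^+ 2)) u.

(* F is a function on M'; its values outside M' are irrelevant. *)
Record finsler (M' : set TM) F : Prop := {
  finsler_nonempty : M' !=set0;
  finsler_open : mopen M';
  finsler_proj : @tproj _ _ M @` M' = setT;
  finsler_zero : range (@zero_section _ _ M) `&` M' = set0;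
  finsler_pos : forall u, M' u -> 0 < F u;
  finsler_smooth : smooth_on (S := R^o) M' F;
  finsler_homo : forall (k : R) u v, 0 < k -> M' u -> M' v ->
    tproj v = tproj u -> tfiber v = k *: tfiber u ->
    F v ^+ 2 = k ^+ 2 * F u ^+ 2;
  finsler_posdef : forall c u, M' u -> dom c (tproj u) ->
    forall y : 'rV[R]_m, y != 0 ->
      0 < \sum_i \sum_j fmetric F c i j u * y 0 i * y 0 j }.

Definition vertical u : set (tvector TM) :=
  [set v | tangent_space (A := TM) u v /\
           tangent_map (A := TM) (@tproj _ _ M) u v (0 : tvector M)].

Definition nonlinear_connection (M' : set TM) (H : TM -> set (tvector TM)) : Prop :=
  distribution (A := TM) m M' H /\
  forall u, M' u ->
    H u `&` vertical u = [set 0] /\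
    [set h + w | h in H u & w in vertical u] = tangent_space (A := TM) u.

(* N c j i is the coefficient N^j_i in the chart c; its upper index is j. *)
Definition connection_coef := chart M -> 'I_m -> 'I_m -> TM -> R.

Definition vec_delta (N : connection_coef) c u i : tvector TM :=
  vec_x c u i - \sum_j N c j i u *: vec_y c u j.

Definition coef_of (M' : set TM) (H : TM -> set (tvector TM)) (N : connection_coef) :=
  forall c u, M' u -> dom c (tproj u) -> H u = tspan (A := TM) (vec_delta N c u).

Definition delta (N : connection_coef) c i (f : TM -> R) : TM -> R :=
  fun u => dx c i f u - \sum_j N c j i u * dy c j f u.

(* R^k_ij *)
Definition curv (N : connection_coef) c k i j : TM -> R :=
  fun u => delta N c j (N c k i) u - delta N c i (N c k j) u.

Record associate_acs (M' : set TM) (N : connection_coef)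
    (J : TM -> tvector TM -> tvector TM) : Prop := {
  acs_bundle_map : forall u v, M' u ->
    tangent_space (A := TM) u v -> tangent_space (A := TM) u (J u v);
  acs_linear : forall u (a : R) v w, M' u ->
    tangent_space (A := TM) u v -> tangent_space (A := TM) u w ->
    J u (a *: v + w) = a *: J u v + J u w;
  acs_delta : forall c u i, M' u -> dom c (tproj u) ->
    J u (vec_delta N c u i) = - vec_y c u i;
  acs_vert : forall c u i, M' u -> dom c (tproj u) ->
    J u (vec_y c u i) = vec_delta N c u i }.

(* The values of the 1-forms dx^i, dy^i and \delta y^i on a tangent vector. *)
Definition cov_dx c i (v : tvector TM) : R := v c 0 (lshift m i).
Definition cov_dy c i (v : tvector TM) : R := v c 0 (rshift m i).
Definition cov_deltay (N : connection_coef) c u i (v : tvector TM) : R :=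
  cov_dy c i v + \sum_j N c i j u * cov_dx c j v.

Definition sasaki_metric (M' : set TM) F (N : connection_coef)
    (G : TM -> tvector TM -> tvector TM -> R) : Prop :=
  forall c u, M' u -> dom c (tproj u) -> forall v w : tvector TM,
    tangent_space (A := TM) u v -> tangent_space (A := TM) u w ->
    G u v w =
      \sum_i \sum_j fmetric F c i j u * cov_dx c i v * cov_dx c j w
      + \sum_i \sum_j
          fmetric F c i j u * cov_deltay N c u i v * cov_deltay N c u j w.

Definition fundamental_form (J : TM -> tvector TM -> tvector TM)
    (G : TM -> tvector TM -> tvector TM -> R) : form2 TM :=
  fun u X Y => G u X (J u Y).

Definition almost_kahler (M' : set TM) (J : TM -> tvector TM -> tvector TM)
    (G : TM -> tvector TM -> tvector TM -> R) : Prop :=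
  closed_form2 (A := TM) M' (fundamental_form J G).

End Finsler.

(* Main.v *)
Require Import Defs.
From HB Require Import structures.
From mathcomp Require Import all_boot all_order all_algebra.
From mathcomp Require Import all_classical all_reals all_analysis.
From mathcomp Require Import ring lra.

(** In a chart (x, y) of TM write X_a and Y_a for the partial derivatives along
    x^a and y^a.  From J, G and the relation d/dx^i = delta_i + N^k_i d/dy^k the
    components of the fundamental form Phi are

      Phi(x_i, y_j) = g_ij,        Phi(y_i, y_j) = 0,
      Phi(x_i, x_j) = N^k_j g_ki - N^k_i g_kj

    ([form_xy], [form_yy], [form_xx]), so that dPhi has four kinds of components.
    The component yyy is 0.  The component xyy is a difference Y_j g_ki - Y_i g_kj,
    which vanishes because g is half the y-Hessian of F^2 and third partial
    derivatives of a smooth function commute ([dy_fmetric]).  The component xxy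
    is the left-hand side of the first condition, once the symmetry of Y_a g_ij
    has been used to trade Y_i g_hk for Y_h g_ik ([dPhi_xxy]).  The component xxx
    is the left-hand side of the second condition plus a combination, with
    coefficients N^a_i, of components xxy ([dPhi_xxx]); this is the evaluation of
    dPhi on delta_i, delta_j, delta_k, where only the vertical brackets
    [delta_i, delta_j] = R^h_ij d/dy^h contribute.  Hence dPhi = 0 exactly when
    both conditions hold.

    Three analytic facts stand behind these computations.  Partial derivatives
    commute ([derive_comm]).  The transition maps of TM are differentiable, so
    that the coordinate vectors are tangent vectors in the sense of [tangent_space]
    and the defining properties of J and G apply to them
    ([tangent_space_coord_vec]).  The coefficients N^j_i are differentiable, which
    is needed for the product rule: a local smooth frame of the distribution has
    the form X_i = A_i^k delta_k with A invertible, so N is the quotient of the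
    vertical by the horizontal components of the frame
    ([connection_coef_diff]). *)

Set Implicit Arguments.
Unset Strict Implicit.
Unset Printing Implicit Defensive.

Import Order.TTheory GRing.Theory Num.Theory.
Import numFieldNormedType.Exports.

Local Open Scope classical_set_scope.
Local Open Scope ring_scope.

(** * Differentiability of matrix-valued functions *)

Section Calculus.
Context {R : realType} {V : normedModType R}.

(** Being differentiable is a local property: the difference of the two
    functions vanishes near x, so f and g have the same first-order expansion
    there. *)
Lemma near_eq_differentiable {W : normedModType R} (f g : V -> W) (x : V) :
  (\forall y \near x, f y = g y) -> differentiable f x -> differentiable g x.
Proof.
move=> fg df; have /diff_locallyP[dfc dfE] := df.
have gE : g \o shift x = cst (g x) + 'd f x +o_ 0 id.
  apply/eqaddoP => e e0; have /eqaddoP/(_ _ e0) he := dfE.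
  have fg0 : \forall h \near (0 : V), f (h + x) = g (h + x).
    by move: fg; rewrite (near_shift 0 x); apply: filterS => h /=; rewrite subr0.
  near=> h.
  have : `|((f \o shift x) - (cst (f x) + 'd f x)) h| <= e * `|id h| by near: h.
  rewrite !fctE /= (nbhs_singleton fg).
  by rewrite (_ : f (h + x) = g (h + x)) //; near: h.
apply/diff_locallyP.
have -> : 'd g x = 'd f x :> (V -> W) by apply: diff_unique.
by split.
Unshelve. all: by end_near. Qed.

Lemma differentiable_mx m n (f : V -> 'M[R]_(m, n)) (x : V) :
  (forall i j, differentiable (fun y => f y i j) x) -> differentiable f x.
Proof.
move=> df.
have -> : f = \sum_(i < m) \sum_(j < n) (fun y => f y i j *: delta_mx i j).
  apply/funext => y; rewrite fct_sumE {1}[f y]matrix_sum_delta.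
  by apply: eq_bigr => i _; rewrite fct_sumE.
apply: differentiable_sum => i; apply: differentiable_sum => j.
exact: differentiableZl.
Qed.

Lemma differentiable_entry m n (f : V -> 'M[R]_(m, n)) (x : V) i j :
  differentiable f x -> differentiable (fun y => f y i j) x.
Proof.
move=> df.
apply: (@differentiable_comp _ _ _ _ f (fun N : 'M[R]_(m, n) => N i j)) => //.
exact: differentiable_coord.
Qed.

Lemma differentiable_bigsum (I : Type) (r : seq I) (P : pred I) (f : I -> V -> R)
    (x : V) :
  (forall i, P i -> differentiable (f i) x) ->
  differentiable (fun y => \sum_(i <- r | P i) f i y) x.
Proof.
move=> df; elim: r => [|i r IH].
  by under eq_fun do rewrite big_nil; exact: differentiable_cst.
under eq_fun do rewrite big_cons; case Pi: (P i) => //.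
by apply: differentiableD => //; exact: df.
Qed.

Lemma differentiable_bigprod (I : Type) (r : seq I) (P : pred I) (f : I -> V -> R)
    (x : V) :
  (forall i, P i -> differentiable (f i) x) ->
  differentiable (fun y => \prod_(i <- r | P i) f i y) x.
Proof.
move=> df; elim: r => [|i r IH].
  by under eq_fun do rewrite big_nil; exact: differentiable_cst.
under eq_fun do rewrite big_cons; case Pi: (P i) => //.
by apply: differentiableM => //; exact: df.
Qed.

Lemma differentiable_mulmx m n p (f : V -> 'M[R]_(m, n)) (g : V -> 'M[R]_(n, p))
    (x : V) :
  differentiable f x -> differentiable g x ->
  differentiable (fun y => f y *m g y) x.
Proof.
move=> df dg; apply: differentiable_mx => i j.
under eq_fun do rewrite mxE.
apply: differentiable_bigsum => k _.
by apply: differentiableM; exact: differentiable_entry.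
Qed.

Lemma differentiable_det n (f : V -> 'M[R]_n) (x : V) :
  (forall i j, differentiable (fun y => f y i j) x) ->
  differentiable (fun y => \det (f y)) x.
Proof.
move=> df; apply: differentiable_bigsum => s _.
apply: differentiableM; first exact: differentiable_cst.
by apply: differentiable_bigprod => i _.
Qed.

(** Cramer's rule: near x the inverse is the adjugate divided by the
    determinant, both polynomial in the entries. *)
Lemma differentiable_invmx n (f : V -> 'M[R]_n) (x : V) :
  (\forall y \near x, f y \in unitmx) -> differentiable f x ->
  differentiable (fun y => invmx (f y)) x.
Proof.
move=> fU df.
apply: (@near_eq_differentiable _ (fun y => (\det (f y))^-1 *: \adj (f y))).
  by near=> y; rewrite /invmx ifT//; near: y.
apply: differentiable_mx => i j.
under eq_fun do rewrite mxE.
have dfij i' j' : differentiable (fun y => f y i' j') x by exact: differentiable_entry.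
apply: differentiableM.
  apply: differentiableV; first exact: differentiable_det.
  by rewrite -unitfE -unitmxE (nbhs_singleton fU).
under eq_fun do rewrite mxE.
apply: differentiableM; first exact: differentiable_cst.
apply: differentiable_det => i' j'.
by under eq_fun do rewrite !mxE.
Unshelve. all: by end_near. Qed.

End Calculus.

(** * Symmetry of second derivatives *)

Section Schwarz.
Context {R : realType} {V : normedModType R}.

Lemma is_derive_along_line (f : V -> R) (y v : V) (t : R) :
  differentiable f (y + t *: v) ->
  is_derive t 1 (fun s : R => f (y + s *: v)) ('D_v f (y + t *: v)).
Proof.
move=> df.
have [dg gE] : is_diff t (cst y + ( *:%R^~ v)) (0 + ( *:%R^~ v)).
  exact: is_diffD.
have dfg : differentiable (f \o (cst y + ( *:%R^~ v))) t.
  exact: differentiable_comp.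
split; first exact: diff_derivable.
by rewrite deriveE// diff_comp//= gE deriveE //= fctE /= add0r scale1r.
Qed.

(** The mean value theorem, applied to t |-> f (x + h w + t v) - f (x + t v),
    turns the second difference into h times an increment of 'D_v f over the
    vector h w; differentiability of 'D_v f at the single point x suffices to
    compare this increment with h times its differential at w. *)
Lemma cvg_second_difference (f : V -> R) (x v w : V) :
  (\forall y \near x, differentiable f y) -> differentiable ('D_v f) x ->
  (fun h : R => (f (x + h *: w + h *: v) - f (x + h *: v)
                 - (f (x + h *: w) - f x)) / h ^+ 2) @ 0^'+
    --> 'D_w ('D_v f) x.
Proof.
move=> nf dDf; rewrite deriveE//.
have /diff_locallyP[_ /eqaddoP oD] := dDf.
apply/cvgrPdist_le => e e0.
(* All the vectors s w + t v with s, t in [0, h] have norm at most h C; the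
   summand 1 keeps C positive when v = w = 0. *)
pose C := `|v| + `|w| + 1.
have C0 : 0 < C by rewrite /C ltr_wpDl// addr_ge0.
have e'0 : 0 < e / (2 * C) by rewrite divr_gt0// mulr_gt0.
have nf0 : \forall z \near (0 : V), differentiable f (x + z).
  move: nf; rewrite (near_shift 0 x).
  by apply: filterS => h /=; rewrite subr0 addrC.
have [r /= r0 rP] : exists2 r : R, 0 < r & forall z : V, `|z| < r ->
    differentiable f (x + z) /\
    `|'D_v f (x + z) - 'D_v f x - 'd ('D_v f) x z| <= e / (2 * C) * `|z|.
  have oD' : \forall z \near (0 : V),
      `|'D_v f (x + z) - 'D_v f x - 'd ('D_v f) x z| <= e / (2 * C) * `|z|.
    by apply: filterS (oD _ e'0) => z; rewrite !fctE /= opprD addrA [z + x]addrC.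
  have [r /= r0 rP] := (@nbhs_norm0P R V _).1 (filterI nf0 oD').
  by exists r.
near=> h.
have h0 : 0 < h by [].
have hCr : h * C < r.
  by rewrite -ltr_pdivlMr//; near: h; apply: nbhs_right_lt; exact: divr_gt0.
have small (s t : R) : 0 <= s <= h -> 0 <= t <= h -> `|s *: w + t *: v| <= h * C.
  move=> /andP[s0 sh] /andP[t0 th]; rewrite (le_trans (ler_normD _ _))// !normrZ.
  rewrite (ger0_norm s0) (ger0_norm t0) /C 2!mulrDr mulr1.
  have := ler_wpM2r (normr_ge0 v) th; have := ler_wpM2r (normr_ge0 w) sh.
  by move: h0; lra.
pose phi (t : R) := f (x + h *: w + t *: v) - f (x + t *: v).
have phi_d t : 0 <= t <= h -> is_derive t 1 phi
    ('D_v f (x + h *: w + t *: v) - 'D_v f (x + t *: v)).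
  move=> th; apply: is_deriveB; apply: is_derive_along_line.
    rewrite -addrA; apply: (rP _ _).1; rewrite (le_lt_trans (small _ _ _ th))//.
    by rewrite lexx ltW.
  apply: (rP _ _).1; rewrite -[_ *: v]add0r -(scale0r w).
  by rewrite (le_lt_trans (small _ _ _ th))// lexx ltW.
have [||t th] := @MVT _ phi
  (fun t => 'D_v f (x + h *: w + t *: v) - 'D_v f (x + t *: v)) 0 h h0.
- by move=> t; rewrite in_itv /= => /andP[t0 th]; apply: phi_d; rewrite !ltW.
- apply: derivable_within_continuous => t; rewrite in_itv /= => th.
  by have [] := phi_d _ th.
rewrite /phi !scale0r !addr0 subr0 => ->.
have t0h : 0 <= t <= h by move: th; rewrite in_itv /= => /andP[? ?]; rewrite !ltW.
rewrite -addrA expr2 -mulf_div divff ?gt_eqF// mulr1.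
have h0h : 0 <= h <= h by rewrite lexx ltW.
have zh : 0 <= (0:R) <= h by rewrite lexx ltW.
have s1 := small _ _ h0h t0h.
have s2 := small _ _ zh t0h.
rewrite scale0r add0r in s2.
have [_ r1] := rP _ (le_lt_trans s1 hCr).
have [_ r2] := rP _ (le_lt_trans s2 hCr).
have Lw : 'd ('D_v f) x w =
    ('d ('D_v f) x (h *: w + t *: v) - 'd ('D_v f) x (t *: v)) / h.
  by rewrite linearD addrK linearZ /= mulrC mulKf// gt_eqF.
rewrite Lw -mulrBl normrM normfV (ger0_norm (ltW h0)) ler_pdivrMr//.
set a := 'd _ _ _ in r1 *; set b := 'd _ _ _ in r2 *.
set p := 'D_v f _ in r1 *; set q := 'D_v f _ in r2 *.
set o := 'D_v f _ in r1 r2.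
have -> : a - b - (p - q) = (q - o - b) - (p - o - a) by ring.
rewrite (le_trans (ler_normB _ _))//.
have -> : e * h = e / (2 * C) * (h * C) + e / (2 * C) * (h * C).
  by field; rewrite gt_eqF.
by apply: lerD; [apply: (le_trans r2)|apply: (le_trans r1)]; rewrite ler_wpM2l// ltW.
Unshelve. all: by end_near. Qed.

(** The second difference is symmetric in v and w, so the two
    iterated derivatives are limits of the same quotient. *)
Lemma derive_comm (f : V -> R) (x v w : V) :
  (\forall y \near x, differentiable f y) ->
  differentiable ('D_v f) x -> differentiable ('D_w f) x ->
  'D_w ('D_v f) x = 'D_v ('D_w f) x.
Proof.
move=> nf dv dw.
have Dvw := @cvg_second_difference f x v w nf dv.
have Dwv := @cvg_second_difference f x w v nf dw.
have E : (fun h : R => (f (x + h *: w + h *: v) - f (x + h *: v)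
                 - (f (x + h *: w) - f x)) / h ^+ 2) =
  (fun h : R => (f (x + h *: v + h *: w) - f (x + h *: w)
                 - (f (x + h *: v) - f x)) / h ^+ 2).
  apply/funext => h; rewrite [x + _ + h *: v]addrAC; congr (_ / _); ring.
rewrite E in Dvw; exact: (cvg_unique _ Dvw Dwv).
Qed.
End Schwarz.

(** * Functions of class C^k *)

Section SmoothFunctions.
Context {R : realType} {V : normedModType R}.

Lemma Ck_eq_on {W : normedModType R} k (f g : V -> W) (U : set V) : open U ->
  (forall x, U x -> f x = g x) -> Ck k f U -> Ck k g U.
Proof.
move=> oU; elim: k f g => [|k IH] f g fg /=.
  move=> Cf x Ux; suff : g @ x --> f x by rewrite fg.
  apply: cvg_trans (Cf x Ux); apply: near_eq_cvg.
  by apply: filterS (open_nbhs_nbhs (conj oU Ux)) => y; exact: fg.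
have nfg x : U x -> \forall y \near x, f y = g y.
  by move=> Ux; apply: filterS (open_nbhs_nbhs (conj oU Ux)) => y; exact: fg.
move=> [df Cf]; split=> [x Ux|v].
  by apply: (near_eq_differentiable (nfg x Ux)); exact: df.
by apply: IH (Cf v) => x Ux; apply: near_eq_derive; exact: nfg.
Qed.

(** Not immediate from the definition: the recursion puts the weakest
    condition, continuity, at the bottom, and differentiability has to be
    converted to it there. *)
Lemma CkW {W : normedModType R} k (f : V -> W) (U : set V) :
  Ck k.+1 f U -> Ck k f U.
Proof.
elim: k f => [|k IH] f [df Cf].
  by move=> x Ux; apply: differentiable_continuous; exact: df.
by split=> // v; apply: IH; exact: Cf.
Qed.

Lemma CkD {W : normedModType R} k (f g : V -> W) (U : set V) : open U ->
  Ck k f U -> Ck k g U -> Ck k (f + g) U.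
Proof.
move=> oU; elim: k f g => [|k IH] f g.
  by move=> Cf Cg x Ux; apply: continuousD; [exact: Cf|exact: Cg].
move=> [df Cf] [dg Cg]; split=> [x Ux|v].
  by apply: differentiableD; [exact: df|exact: dg].
apply: Ck_eq_on (IH _ _ (Cf v) (Cg v)) => // x Ux.
by rewrite deriveD//; apply: diff_derivable; [exact: df|exact: dg].
Qed.

Lemma CkM k (f g : V -> R^o) (U : set V) : open U ->
  Ck k f U -> Ck k g U -> Ck k (f * g : V -> R^o) U.
Proof.
move=> oU; elim: k f g => [|k IH] f g.
  by move=> Cf Cg x Ux; apply: continuousM; [exact: Cf|exact: Cg].
move=> Ckf Ckg; have [df Cf] := Ckf; have [dg Cg] := Ckg.
split=> [x Ux|v].
  by apply: differentiableM; [exact: df|exact: dg].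
have CM : Ck k (f * 'D_v g + g * 'D_v f) U.
  by apply: CkD => //; apply: IH; [exact: CkW|exact: Cg|exact: CkW|exact: Cf].
apply: Ck_eq_on CM => // x Ux; rewrite -[RHS]/('D_v (f * g) x).
by rewrite deriveM//; apply: diff_derivable; [exact: df|exact: dg].
Qed.

Lemma smoothM (f g : V -> R^o) (U : set V) : open U ->
  smooth f U -> smooth g U -> smooth (f * g : V -> R^o) U.
Proof. by move=> oU sf sg k; exact: CkM. Qed.

Lemma smooth_derive {W : normedModType R} (f : V -> W) (U : set V) v :
  smooth f U -> smooth ('D_v f) U.
Proof. by move=> sf k; have [_] := sf k.+1; apply. Qed.

Lemma smooth_differentiable {W : normedModType R} (f : V -> W) (U : set V) x :
  smooth f U -> U x -> differentiable f x.
Proof. by move=> sf Ux; have [df _] := sf 1; exact: df. Qed.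

Lemma smooth_derive_comm (f : V -> R^o) (U : set V) x v w : open U ->
  smooth f U -> U x -> 'D_v ('D_w f) x = 'D_w ('D_v f) x.
Proof.
move=> oU sf Ux; apply: derive_comm.
- by apply: filterS (open_nbhs_nbhs (conj oU Ux)) => y; exact: smooth_differentiable.
- exact: smooth_differentiable (smooth_derive w sf) Ux.
- exact: smooth_differentiable (smooth_derive v sf) Ux.
Qed.

End SmoothFunctions.

(** * Calculus in the charts of an atlas *)

Section LocalRep.
Context {R : realType} {n : nat} (A : atlas R n).
Hypothesis chart_inj : forall c : chart A, set_inj (dom c) (mcoord c).
Implicit Types (c d : chart A) (p q : A) (W : set A).

Lemma local_repE (S : normedModType R) c (f : A -> S) p :
  dom c p -> local_rep c f (mcoord c p) = f p.
Proof.
move=> cp; rewrite /local_rep; case: xgetP => [y -> /= [q [cq qp] <-]|/(_ (f p))].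
  by congr f; exact: chart_inj (mem_set cq) (mem_set cp) qp.
by case; exists p.
Qed.

Lemma local_rep_out (S : normedModType R) c (f : A -> S) x :
  ~ (mcoord c @` dom c) x -> local_rep c f x = 0.
Proof.
move=> cx; rewrite /local_rep; case: xgetP => // y _ [q [cq qx] _].
by case: cx; exists q.
Qed.

Lemma local_rep_lift1 (S T : normedModType R) (op : S -> T) c (f : A -> S) :
  op 0 = 0 -> local_rep c (op \o f) = op \o local_rep c f.
Proof.
move=> op0; apply/funext => x /=.
have [[p cp <-]|cx] := pselect ((mcoord c @` dom c) x).
  by rewrite !local_repE.
by rewrite !local_rep_out.
Qed.

(** The value 0 taken by local representatives outside the chart is preserved
    by op, so the equality holds on the whole space and not only on the image
    of the chart. *)
Lemma local_rep_lift2 (S T U : normedModType R) (op : S -> T -> U) c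
    (f : A -> S) (g : A -> T) : op 0 0 = 0 ->
  local_rep c (fun p => op (f p) (g p)) =
  (fun x => op (local_rep c f x) (local_rep c g x)).
Proof.
move=> op0; apply/funext => x.
have [[p cp <-]|cx] := pselect ((mcoord c @` dom c) x).
  by rewrite !local_repE.
by rewrite !local_rep_out.
Qed.

(** Derivatives at p only see functions near p, so a neighbourhood condition at
    p replaces the openness of W in all charts. *)
Definition chart_nbhs c W p := nbhs (mcoord c p) (mcoord c @` (W `&` dom c)).

Lemma mopen_chart_nbhs c W p : mopen W -> W p -> dom c p -> chart_nbhs c W p.
Proof. by move=> oW Wp cp; apply: open_nbhs_nbhs; split; [exact: oW|exists p]. Qed.

Lemma near_local_rep (S : normedModType R) c W p (f g : A -> S) :
  chart_nbhs c W p -> (forall q, W q -> dom c q -> f q = g q) ->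
  \forall x \near mcoord c p, local_rep c f x = local_rep c g x.
Proof.
by move=> nW fg; apply: filterS nW => _ [q [Wq cq] <-]; rewrite !local_repE ?fg.
Qed.

Definition chart_diff c p (f : A -> R) :=
  differentiable (local_rep c (f : A -> R^o)) (mcoord c p).

Lemma pderivE c a p (f : A -> R) :
  pderiv c a f p = 'D_('e_a) (local_rep c (f : A -> R^o)) (mcoord c p).
Proof. by []. Qed.

Lemma chart_diff_near c W p (f g : A -> R) : chart_nbhs c W p ->
  (forall q, W q -> dom c q -> f q = g q) -> chart_diff c p f -> chart_diff c p g.
Proof.
by move=> nW fg; apply: near_eq_differentiable; exact: near_local_rep nW fg.
Qed.

Lemma pderiv_near c a W p (f g : A -> R) : chart_nbhs c W p ->
  (forall q, W q -> dom c q -> f q = g q) -> pderiv c a f p = pderiv c a g p.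
Proof.
move=> nW fg; apply: near_eq_derive.
exact: (@near_local_rep R^o c W p f g).
Qed.

Lemma chart_diff0 c p : chart_diff c p (fun=> 0).
Proof.
rewrite /chart_diff (_ : local_rep _ _ = cst 0); first exact: differentiable_cst.
apply/funext => x.
have [[q cq <-]|cx] := pselect ((mcoord c @` dom c) x).
  by rewrite local_repE.
by rewrite local_rep_out.
Qed.

Lemma pderiv0 c a p : pderiv c a (fun=> 0) p = 0.
Proof.
rewrite /pderiv (_ : local_rep _ _ = cst 0) ?derive_cst//.
apply/funext => x.
have [[q cq <-]|cx] := pselect ((mcoord c @` dom c) x).
  by rewrite local_repE.
by rewrite local_rep_out.
Qed.

Lemma chart_diffD c p (f g : A -> R) : chart_diff c p f -> chart_diff c p g ->
  chart_diff c p (fun q => f q + g q).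
Proof.
move=> df dg; rewrite /chart_diff.
rewrite (@local_rep_lift2 _ _ R^o (fun s t : R^o => s + t)) ?addr0//.
exact: (differentiableD df dg).
Qed.

Lemma pderivD c a p (f g : A -> R) : chart_diff c p f -> chart_diff c p g ->
  pderiv c a (fun q => f q + g q) p = pderiv c a f p + pderiv c a g p.
Proof.
move=> df dg; rewrite !pderivE.
rewrite (@local_rep_lift2 _ _ R^o (fun s t : R^o => s + t)) ?addr0//.
by apply: deriveD; exact: diff_derivable.
Qed.

Lemma chart_diffN c p (f : A -> R) : chart_diff c p f ->
  chart_diff c p (fun q => - f q).
Proof.
move=> df; rewrite /chart_diff.
rewrite (@local_rep_lift1 _ R^o (fun s : R^o => - s)) ?oppr0//.
exact: (differentiableN df).
Qed.

Lemma pderivN c a p (f : A -> R) : chart_diff c p f ->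
  pderiv c a (fun q => - f q) p = - pderiv c a f p.
Proof.
move=> df; rewrite !pderivE.
rewrite (@local_rep_lift1 _ R^o (fun s : R^o => - s)) ?oppr0//.
by apply: deriveN; exact: diff_derivable.
Qed.

Lemma chart_diffZ c p (a : R) (f : A -> R) : chart_diff c p f ->
  chart_diff c p (fun q => a * f q).
Proof.
move=> df; rewrite /chart_diff.
rewrite (@local_rep_lift1 R^o R^o (fun s : R^o => a * s : R^o)) ?mulr0//.
exact: (differentiableZ a df).
Qed.

Lemma pderivZ c p (a : R) (f : A -> R) i : chart_diff c p f ->
  pderiv c i (fun q => a * f q) p = a * pderiv c i f p.
Proof.
move=> df; rewrite !pderivE.
rewrite (@local_rep_lift1 R^o R^o (fun s : R^o => a * s : R^o)) ?mulr0//.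
by apply: deriveZ; exact: diff_derivable.
Qed.

Lemma chart_diffM c p (f g : A -> R) : chart_diff c p f -> chart_diff c p g ->
  chart_diff c p (fun q => f q * g q).
Proof.
move=> df dg; rewrite /chart_diff.
rewrite (@local_rep_lift2 _ _ R^o (fun s t : R^o => s * t : R^o)) ?mulr0//.
exact: (differentiableM df dg).
Qed.

Lemma pderivM c a p (f g : A -> R) : dom c p ->
  chart_diff c p f -> chart_diff c p g ->
  pderiv c a (fun q => f q * g q) p = f p * pderiv c a g p + g p * pderiv c a f p.
Proof.
move=> cp df dg; rewrite !pderivE.
rewrite (@local_rep_lift2 _ _ R^o (fun s t : R^o => s * t : R^o)) ?mulr0//.
rewrite -(@local_repE R^o c f p cp) -(@local_repE R^o c g p cp).
have dM := @deriveM R _ (local_rep c (f : A -> R^o)) (local_rep c (g : A -> R^o))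
  (mcoord c p) 'e_a.
by apply: dM; exact: diff_derivable.
Qed.

Lemma chart_diff_sum c p (I : Type) (r : seq I) (f : I -> A -> R) :
  (forall i, chart_diff c p (f i)) -> chart_diff c p (fun q => \sum_(i <- r) f i q).
Proof.
move=> df; elim: r => [|i r IH].
  by under eq_fun do rewrite big_nil; exact: chart_diff0.
by under eq_fun do rewrite big_cons; exact: chart_diffD.
Qed.

Lemma pderiv_sum c a p (I : Type) (r : seq I) (f : I -> A -> R) :
  (forall i, chart_diff c p (f i)) ->
  pderiv c a (fun q => \sum_(i <- r) f i q) p = \sum_(i <- r) pderiv c a (f i) p.
Proof.
move=> df; elim: r => [|i r IH].
  by rewrite big_nil; under eq_fun do rewrite big_nil; exact: pderiv0.
rewrite big_cons -IH; under eq_fun do rewrite big_cons.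
by rewrite pderivD//; exact: chart_diff_sum.
Qed.

(** The transition from a chart to itself is the identity on its image, a
    neighbourhood of the point. *)
Lemma tvec_chart c p W (a : 'rV[R]_n) : dom c p -> chart_nbhs c W p ->
  tvec c p a c = a.
Proof.
move=> cp nW; rewrite /tvec asboolT//.
rewrite -[RHS](derive_id (mcoord c p)).
apply: (@near_eq_derive R 'rV[R]_n 'rV[R]_n).
by apply: filterS nW => _ [q [_ cq] <-]; rewrite local_repE.
Qed.

Section TangentSpace.
Variable p : A.
Hypothesis overlap_nbhs : forall c d, dom c p -> dom d p -> chart_nbhs c (dom d) p.
Hypothesis transition_diff : forall c d, dom c p -> dom d p ->
  differentiable (local_rep c (mcoord d)) (mcoord c p).

Lemma tangent_space_linear (a : R) (v w : tvector A) :
  tangent_space p v -> tangent_space p w -> tangent_space p (a *: v + w).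
Proof.
move=> [vT v0] [wT w0]; split=> [c d cp dp|c cp]; rewrite !fctE; last first.
  by rewrite v0// w0// scaler0 addr0.
have dcd := transition_diff cp dp.
by rewrite (vT c d cp dp) (wT c d cp dp) !(deriveE _ dcd) linearP.
Qed.

Lemma tangent_space_sum (I : Type) (r : seq I) (a : I -> R) (v : I -> tvector A) :
  (forall i, tangent_space p (v i)) -> tangent_space p (\sum_(i <- r) a i *: v i).
Proof.
move=> vT; elim: r => [|i r IH]; last first.
  by rewrite big_cons; exact: tangent_space_linear.
by rewrite big_nil; split=> // c d _ _; rewrite derive0.
Qed.

(** Chain rule: on the overlap of c and d, the transition from c to e is the
    composite of the transitions from c to d and from d to e. *)
Lemma tangent_space_tvec c a : dom c p -> tangent_space p (tvec c p a).
Proof.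
move=> cp; split=> [d e dp ep|d dp]; last by rewrite /tvec asboolF.
rewrite /tvec !(asboolT dp, asboolT ep).
have dcd := transition_diff cp dp.
have dde : differentiable (local_rep d (mcoord e)) (local_rep c (mcoord d) (mcoord c p)).
  by rewrite (local_repE _ cp); exact: transition_diff.
rewrite -[in RHS](local_repE (mcoord d) cp) (deriveE _ dde) (deriveE _ dcd).
rewrite -[RHS]/(('d _ _ \o 'd _ _) a) -diff_comp// -deriveE;
  last exact: differentiable_comp.
apply: (@near_eq_derive R 'rV[R]_n 'rV[R]_n).
apply: filterS (overlap_nbhs cp dp) => _ [q [dq cq] <-] /=.
by rewrite !local_repE.
Qed.

End TangentSpace.

End LocalRep.

(** * Charts of the tangent bundle *)

Section TangentBundleCharts.
Context {R : realType} {m : nat} (M : atlas R m).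
Hypothesis hM : smooth_manifold M.
Notation TM := (tangent_bundle M).
Implicit Types (c d : chart M) (u v : TM).

(** A tangent vector is determined by its components in one chart: the others
    follow by the transformation law, or are 0 by convention. *)
Lemma tangent_bundle_chart_inj (c : chart TM) : set_inj (dom c) (mcoord c).
Proof.
move=> [[p v] /= [vT v0]] [[q w] /= [wT w0]]; rewrite !inE /= /tproj /= => cp cq.
move=> /eq_row_mx[pq vw]; rewrite /tfiber /= in vw.
have {}pq : p = q := chart_inj hM (mem_set cp) (mem_set cq) pq.
subst q.
have {}vw : v = w.
  apply/funext => d; have [dp|dp] := pselect (dom d p); last by rewrite v0// w0.
  by rewrite (vT c d cp dp) (wT c d cp dp) vw.
by subst w; congr exist; exact: Prop_irrelevance.
Qed.

Section AtPoint.
Variables (M' : set TM) (u : TM).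
Hypotheses (oM' : mopen M') (M'u : M' u).

(** Openness of M' in the charts of TM provides the points; only the base
    point has to be moved into the overlap, by the openness of overlaps in M
    and the continuity of the projection. *)
Lemma tangent_bundle_overlap c d : dom c (tproj u) -> dom d (tproj u) ->
  chart_nbhs (A := TM) c (M' `&` @dom _ _ TM d) u.
Proof.
move=> cu du.
have n1 : nbhs (@mcoord _ _ TM c u) (@mcoord _ _ TM c @` (M' `&` @dom _ _ TM c)).
  exact: (mopen_chart_nbhs oM').
have n2 : \forall x \near @mcoord _ _ TM c u,
    (mcoord c @` (dom c `&` dom d)) (lsubmx x).
  apply: (@continuous_lsubmx R 1 m m).
  rewrite row_mxKl; apply: open_nbhs_nbhs; split; first exact: chart_open.
  by exists (tproj u).
apply: filterS2 n1 n2 => _ [v [M'v cv] <-]; rewrite row_mxKl => -[p [cp dp] pv].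
exists v => //; split=> //; split=> //=.
by rewrite -(chart_inj hM (mem_set cp) (mem_set cv) pv).
Qed.

(** In coordinates a transition map of TM is (x, y) |-> (phi x, sum_i y_i
    'D_(e_i) phi x) with phi the smooth transition map of M. *)
Lemma tangent_bundle_transition_diff c d : dom c (tproj u) -> dom d (tproj u) ->
  differentiable (local_rep (A := TM) c (@mcoord _ _ TM d)) (@mcoord _ _ TM c u).
Proof.
move=> cu du.
pose phi := local_rep c (mcoord d).
pose O := mcoord c @` (dom c `&` dom d).
have sphi : smooth phi O := chart_smooth hM c d.
have Ou : O (mcoord c (tproj u)) by exists (tproj u).
have lE : lsubmx (@mcoord _ _ TM c u) = mcoord c (tproj u) by rewrite row_mxKl.
have dl : differentiable (lsubmx : 'rV[R]_(m + m) -> 'rV[R]_m) (@mcoord _ _ TM c u).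
  exact: differentiable_lsubmx.
pose psi (z : 'rV[R]_(m + m)) := row_mx (phi (lsubmx z))
  (\row_k \sum_i z 0 (rshift m i) * ('D_('e_i) phi (lsubmx z)) 0 k).
apply: (@near_eq_differentiable _ _ _ psi).
  apply: filterS (tangent_bundle_overlap cu du) => _ [v [[M'v dv] cv] <-].
  have Ov : O (mcoord c (tproj v)) by exists (tproj v).
  rewrite (local_repE tangent_bundle_chart_inj _ cv) /psi row_mxKl /=.
  congr row_mx; first by rewrite /phi (local_repE (chart_inj hM)).
  have [vT _] := svalP v.
  rewrite (vT c d cv dv : tfiber v d = _) -/phi deriveE;
    last exact: smooth_differentiable sphi Ov.
  apply/rowP => k; rewrite mxE.
  rewrite [X in 'd _ _ X]row_sum_delta linear_sum summxE; apply: eq_bigr => i _.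
  rewrite row_mxEr linearZ [RHS]mxE deriveE//; exact: smooth_differentiable sphi Ov.
have comp_l (W : normedModType R) (f : 'rV[R]_m -> W) : smooth f O ->
    differentiable (f \o lsubmx) (@mcoord _ _ TM c u).
  move=> sf; apply: differentiable_comp => //; rewrite lE.
  exact: smooth_differentiable sf Ou.
apply: differentiable_mx => i j.
have [k ->|k ->] := split_ordP j.
  under eq_fun do rewrite row_mxEl.
  exact: differentiable_entry (comp_l _ _ sphi).
under eq_fun do rewrite row_mxEr mxE.
apply: differentiable_bigsum => l _; apply: differentiableM.
  exact: differentiable_coord.
exact: differentiable_entry (comp_l _ _ (smooth_derive _ sphi)).
Qed.

End AtPoint.
End TangentBundleCharts.

(** * Coordinate vectors and connection coefficients *)

Section Connection.
Context {R : realType} {m : nat} (M : atlas R m).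
Hypothesis hM : smooth_manifold M.
Notation TM := (tangent_bundle M).
Implicit Types (c d : chart M) (u v : TM) (i j k : 'I_m).
Variable M' : set TM.
Hypothesis oM' : mopen M'.

Notation TMinj := (tangent_bundle_chart_inj hM).

Lemma chart_nbhs_domain c u : M' u -> dom c (tproj u) ->
  chart_nbhs (A := TM) c M' u.
Proof. exact: (mopen_chart_nbhs oM'). Qed.

Lemma vec_x_chart c u i : M' u -> dom c (tproj u) ->
  vec_x c u i c = 'e_(lshift m i).
Proof. by move=> M'u cu; apply: (tvec_chart TMinj) (chart_nbhs_domain M'u cu). Qed.

Lemma vec_y_chart c u i : M' u -> dom c (tproj u) ->
  vec_y c u i c = 'e_(rshift m i).
Proof. by move=> M'u cu; apply: (tvec_chart TMinj) (chart_nbhs_domain M'u cu). Qed.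

Section AtPoint.
Variables (c : chart M) (u : TM).
Hypotheses (M'u : M' u) (cu : dom c (tproj u)).

Lemma cov_dx_vec_x i j : cov_dx c i (vec_x c u j) = (i == j)%:R.
Proof. by rewrite /cov_dx vec_x_chart// mxE eqxx /= (inj_eq (@lshift_inj _ _)). Qed.

Lemma cov_dx_vec_y i j : cov_dx c i (vec_y c u j) = 0.
Proof. by rewrite /cov_dx vec_y_chart// mxE eqxx /= eq_lrshift. Qed.

Lemma cov_dy_vec_x i j : cov_dy c i (vec_x c u j) = 0.
Proof. by rewrite /cov_dy vec_x_chart// mxE eqxx /= eq_rlshift. Qed.

Lemma cov_dy_vec_y i j : cov_dy c i (vec_y c u j) = (i == j)%:R.
Proof. by rewrite /cov_dy vec_y_chart// mxE eqxx /= (inj_eq (@rshift_inj _ _)). Qed.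

Lemma tangent_space_linear_TM (a : R) (v w : tvector TM) :
  tangent_space (A := TM) u v -> tangent_space (A := TM) u w ->
  tangent_space (A := TM) u (a *: v + w).
Proof.
apply: tangent_space_linear => d e du eu.
exact: (tangent_bundle_transition_diff hM oM').
Qed.

Lemma tangent_space_sum_TM (I : Type) (r : seq I) (a : I -> R) (v : I -> tvector TM) :
  (forall s, tangent_space (A := TM) u (v s)) ->
  tangent_space (A := TM) u (\sum_(s <- r) a s *: v s).
Proof.
apply: tangent_space_sum => d e du eu.
exact: (tangent_bundle_transition_diff hM oM').
Qed.

Lemma tangent_space_coord_vec a : tangent_space (A := TM) u (@coord_vec _ _ TM c u a).
Proof.
apply: (tangent_space_tvec TMinj) => // d e du eu.
  apply: filterS (tangent_bundle_overlap hM oM' M'u du eu).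
  by move=> _ [v [[_ ev] dv] <-]; exists v.
exact: (tangent_bundle_transition_diff hM oM').
Qed.

Variable N : connection_coef M.

Lemma vec_deltaE i :
  vec_delta N c u i = (- 1) *: (\sum_j N c j i u *: vec_y c u j) + vec_x c u i.
Proof. by rewrite scaleN1r addrC. Qed.

Lemma tangent_space_vec_delta i : tangent_space (A := TM) u (vec_delta N c u i).
Proof.
rewrite vec_deltaE; apply: tangent_space_linear_TM; last exact: tangent_space_coord_vec.
by apply: tangent_space_sum_TM => j; exact: tangent_space_coord_vec.
Qed.

Lemma cov_dx_vec_delta i j : cov_dx c i (vec_delta N c u j) = (i == j)%:R.
Proof.
rewrite -cov_dx_vec_x /cov_dx /vec_delta !fctE mxE [X in _ + X]mxE fct_sumE summxE.
rewrite big1 ?subr0// => k _; rewrite mxE.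
by rewrite -/(cov_dx c i (vec_y c u k)) cov_dx_vec_y mulr0.
Qed.

Lemma cov_dy_vec_delta i j : cov_dy c i (vec_delta N c u j) = - N c i j u.
Proof.
rewrite /cov_dy /vec_delta !fctE mxE [X in _ + X]mxE fct_sumE summxE.
rewrite -/(cov_dy c i (vec_x c u j)) cov_dy_vec_x add0r; congr (- _).
rewrite (bigD1 i)//= big1 ?addr0 => [|k ki].
  by rewrite mxE -/(cov_dy c i (vec_y c u i)) cov_dy_vec_y eqxx mulr1.
by rewrite mxE -/(cov_dy c i (vec_y c u k)) cov_dy_vec_y eq_sym (negbTE ki) mulr0.
Qed.

End AtPoint.

(** The coefficients are only given pointwise, through the spaces H u; their
    regularity comes from a local smooth frame X of the distribution. With A
    and B the horizontal and vertical components of X, X_k = A_kl delta_l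
    gives B = - A N^T, so N^T = - A^-1 B. *)
Lemma connection_coef_diff H N c u j i : nonlinear_connection M' H -> coef_of M' H N ->
  M' u -> dom c (tproj u) -> chart_diff (A := TM) c u (N c j i).
Proof.
move=> [dH _] hN M'u cu.
have [U [X [oU Uu UM' sX XP]]] := dH u M'u.
(* The frame, and its horizontal and vertical components, in the chart c. *)
pose rX k := local_rep (A := TM) c (fun q => X k q c).
pose A x := \matrix_(k, l) (rX k x) 0 (lshift m l).
pose B x := \matrix_(k, l) (rX k x) 0 (rshift m l).
have nU : chart_nbhs (A := TM) c U u by exact: (mopen_chart_nbhs oU).
have rX_diff k : differentiable (rX k) (@mcoord _ _ TM c u).
  have [_ /(_ c) sXk] := sX k; apply: smooth_differentiable sXk _.
  by exists u.
have A_diff : differentiable A (@mcoord _ _ TM c u).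
  apply: differentiable_mx => k l; under eq_fun do rewrite mxE.
  exact: differentiable_entry.
have B_diff : differentiable B (@mcoord _ _ TM c u).
  apply: differentiable_mx => k l; under eq_fun do rewrite mxE.
  exact: differentiable_entry.
have XE q : U q -> dom c (tproj q) -> forall k,
    X k q = \sum_l A (@mcoord _ _ TM c q) k l *: vec_delta N c q l.
  move=> Uq cq k; have [_ Hq] := XP q Uq.
  have : tspan (X^~ q) (X k q).
    exists (fun l => (l == k)%:R); rewrite (bigD1 k)//= eqxx scale1r.
    by rewrite big1 ?addr0// => l /negbTE ->; rewrite scale0r.
  rewrite -Hq (hN c q (UM' _ Uq) cq) => -[a aE].
  rewrite aE; apply: eq_bigr => l _; congr (_ *: _).
  rewrite mxE /rX (local_repE TMinj)// aE fct_sumE summxE (bigD1 l)//= big1 ?addr0.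
    rewrite mxE -/(cov_dx c l (vec_delta N c q l)) cov_dx_vec_delta ?eqxx ?mulr1//.
    exact: UM'.
  move=> k' kl; rewrite mxE -/(cov_dx c l (vec_delta N c q k')).
  by rewrite cov_dx_vec_delta// ?[l == _]eq_sym ?(negbTE kl) ?mulr0//; exact: UM'.
(* A row vector killed by A gives a vanishing combination of the frame X. *)
have A_unit q : U q -> dom c (tproj q) -> A (@mcoord _ _ TM c q) \in unitmx.
  move=> Uq cq; rewrite -row_free_unit; apply: inj_row_free => v vA.
  have [fX _] := XP q Uq.
  apply/rowP => k; rewrite mxE; apply: (fX (fun k => v 0 k)).
  under eq_bigr do rewrite XE// scaler_sumr.
  rewrite exchange_big big1//= => l _.
  under eq_bigr do rewrite scalerA.
  rewrite -scaler_suml.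
  have /rowP/(_ l) := vA; rewrite !mxE => ->.
  by rewrite scale0r.
have B_E q : U q -> dom c (tproj q) ->
    B (@mcoord _ _ TM c q) = - (A (@mcoord _ _ TM c q) *m \matrix_(k, l) N c l k q).
  move=> Uq cq; apply/matrixP => k l; rewrite !mxE /rX (local_repE TMinj)// XE//.
  rewrite fct_sumE summxE -sumrN; apply: eq_bigr => k' _; rewrite mxE.
  rewrite -/(cov_dy c l (vec_delta N c q k')) cov_dy_vec_delta//; last exact: UM'.
  by rewrite mulrN !mxE.
apply: (@near_eq_differentiable _ _ R^o
    (fun x => (- (invmx (A x) *m B x) : 'M[R]_m) i j)).
  apply: filterS nU => _ [q [Uq cq] <-].
  rewrite (local_repE TMinj)// B_E// mulmxN opprK mulKmx; last exact: A_unit.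
  by rewrite mxE.
apply: differentiable_entry; apply: differentiableN; apply: differentiable_mulmx => //.
apply: differentiable_invmx => //.
by apply: filterS nU => _ [q [Uq cq] <-]; exact: A_unit.
Qed.

End Connection.

(** * Derivatives of the Finsler metric *)

Section SmoothInChart.
Context {R : realType} {n : nat} (A : atlas R n).
Hypothesis chart_inj : forall c : chart A, set_inj (dom c) (mcoord c).
Variables (W : set A) (c : chart A).
Hypothesis oW : mopen W.

Definition smooth_in_chart (f : A -> R) :=
  smooth (local_rep c (f : A -> R^o)) (mcoord c @` (W `&` dom c)).

Lemma smooth_in_chartM f g : smooth_in_chart f -> smooth_in_chart g ->
  smooth_in_chart (fun p => f p * g p).
Proof.
move=> sf sg; rewrite /smooth_in_chart.
rewrite (@local_rep_lift2 _ _ _ chart_inj _ _ R^o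
  (fun s t : R^o => s * t : R^o)) ?mulr0//.
exact: (smoothM (@oW c) sf sg).
Qed.

(** Reduces iterated derivatives in a chart to iterated derivatives of a single
    function on the coordinate space. *)
Lemma near_local_rep_pderiv p f a : W p -> dom c p ->
  \forall x \near mcoord c p,
    local_rep c (pderiv c a f : A -> R^o) x = 'D_('e_a) (local_rep c (f : A -> R^o)) x.
Proof.
move=> Wp cp; apply: filterS (mopen_chart_nbhs oW Wp cp) => _ [q [_ cq] <-].
by rewrite local_repE.
Qed.

Lemma smooth_in_chart_pderiv f a : smooth_in_chart f ->
  smooth_in_chart (pderiv c a f).
Proof.
move=> sf k; apply: Ck_eq_on (smooth_derive 'e_a sf k); first exact: oW.
by move=> _ [q [Wq cq] <-]; rewrite local_repE.
Qed.

Lemma smooth_in_chart_diff f p : W p -> dom c p -> smooth_in_chart f ->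
  chart_diff c p f.
Proof. by move=> Wp cp sf; apply: smooth_differentiable sf _; exists p. Qed.

Lemma pderiv_comm f a b p : W p -> dom c p -> smooth_in_chart f ->
  pderiv c a (pderiv c b f) p = pderiv c b (pderiv c a f) p.
Proof.
move=> Wp cp sf.
have E i j : pderiv c i (pderiv c j f) p =
    'D_('e_i) ('D_('e_j) (local_rep c (f : A -> R^o))) (mcoord c p).
  exact: near_eq_derive (near_local_rep_pderiv f j Wp cp).
apply: etrans (E a b) (etrans _ (esym (E b a))).
by apply: (smooth_derive_comm _ _ (@oW c) sf); exists p.
Qed.

End SmoothInChart.

Section Metric.
Context {R : realType} {m : nat} (M : atlas R m).
Hypothesis hM : smooth_manifold M.
Notation TM := (tangent_bundle M).
Variables (M' : set TM) (F : TM -> R).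
Hypothesis hF : finsler M' F.
Variables (c : chart M) (u : TM).
Hypotheses (M'u : M' u) (cu : dom c (tproj u)).

Notation TMinj := (tangent_bundle_chart_inj hM).

Lemma energy_smooth : smooth_in_chart M' (c : chart TM) (fun v : TM => F v ^+ 2).
Proof.
have sF : smooth_in_chart M' (c : chart TM) F := finsler_smooth hF c.
exact: (smooth_in_chartM TMinj (finsler_open hF) sF sF).
Qed.

Lemma fmetric_diff i j : chart_diff (A := TM) c u (fmetric F c i j).
Proof.
have oM' := finsler_open hF.
have s1 := smooth_in_chart_pderiv TMinj oM' (rshift m j) energy_smooth.
have s2 := smooth_in_chart_pderiv TMinj oM' (rshift m i) s1.
have d2 : chart_diff (A := TM) c u (dy c i (dy c j (fun v : TM => F v ^+ 2))).
  exact: (@smooth_in_chart_diff _ _ TM M' c _ u M'u cu s2).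
exact: (chart_diffZ TMinj _ d2).
Qed.

Lemma fmetric_sym i j : fmetric F c i j u = fmetric F c j i u.
Proof.
have sE := pderiv_comm TMinj (finsler_open hF) (rshift m i) (rshift m j) M'u cu
  energy_smooth.
by rewrite /fmetric /dy sE.
Qed.

(** Twice the metric is the y-Hessian of F^2, so its y-derivative is a third
    derivative of a smooth function; this is the total symmetry of the Cartan
    tensor. *)
Lemma dy_fmetric k i j : dy c k (fmetric F c i j) u = dy c i (fmetric F c k j) u.
Proof.
have oM' := finsler_open hF.
have s1 : smooth_in_chart M' c (dy c j (fun v : TM => F v ^+ 2)).
  exact: (smooth_in_chart_pderiv TMinj oM' _ energy_smooth).
have d2 l : chart_diff (A := TM) c u (dy c l (dy c j (fun v : TM => F v ^+ 2))).
  apply: (@smooth_in_chart_diff _ _ TM M' c _ u M'u cu).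
  exact: (smooth_in_chart_pderiv TMinj oM' _ s1).
have sE := pderiv_comm TMinj oM' (rshift m k) (rshift m i) M'u cu s1.
have dE l h : dy c h (fmetric F c l j) u =
    2^-1 * dy c h (dy c l (dy c j (fun v : TM => F v ^+ 2))) u.
  exact: (pderivZ TMinj _ _ (d2 l)).
exact: etrans (dE i k) (etrans (congr1 ( *%R 2^-1) sE) (esym (dE k i))).
Qed.

End Metric.

(** * Components of the fundamental form *)

Lemma sum_delta (R : pzRingType) n (f : 'I_n -> R) i :
  \sum_j f j * (j == i)%:R = f i.
Proof.
rewrite (bigD1 i)//= eqxx mulr1 big1 ?addr0// => j /negbTE ->.
by rewrite mulr0.
Qed.

(** The two contractions that make up G (d/dx^i, J (d/dx^j)), with the
    Kronecker deltas coming from the values of the adapted coframe. *)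
Lemma contract_xx (R : comPzRingType) n (h N : 'I_n -> 'I_n -> R) i j :
  (forall k l, h k l = h l k) ->
  \sum_l h i l * N l j + \sum_k \sum_l h k l * N k i * - (l == j)%:R =
  \sum_k (N k j * h k i - N k i * h k j).
Proof.
move=> hS; rewrite -big_split; apply: eq_bigr => k _ /=.
rewrite hS mulrC; congr (_ + _).
rewrite -(sum_delta (fun l => N k i * h k l)) -sumrN.
by apply: eq_bigr => l _; rewrite mulrN [N _ _ * _]mulrC.
Qed.

Section FundamentalForm.
Context {R : realType} {m : nat} (M : atlas R m).
Hypothesis hM : smooth_manifold M.
Notation TM := (tangent_bundle M).
Variables (M' : set TM) (F : TM -> R).
Hypothesis hF : finsler M' F.
Variable N : connection_coef M.
Variables (J : TM -> tvector TM -> tvector TM)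
  (G : TM -> tvector TM -> tvector TM -> R).
Hypotheses (hJ : associate_acs M' N J) (hG : sasaki_metric M' F N G).
Variables (c : chart M) (u : TM).
Hypotheses (M'u : M' u) (cu : dom c (tproj u)).
Implicit Types i j k : 'I_m.

Let oM' := finsler_open hF.
Let T_x i : tangent_space (A := TM) u (vec_x c u i) :=
  tangent_space_coord_vec hM oM' M'u cu _.
Let T_y i : tangent_space (A := TM) u (vec_y c u i) :=
  tangent_space_coord_vec hM oM' M'u cu _.
Let T_d i : tangent_space (A := TM) u (vec_delta N c u i) :=
  tangent_space_vec_delta hM oM' M'u cu N i.

Lemma cov_deltay_vec_x i j : cov_deltay N c u i (vec_x c u j) = N c i j u.
Proof.
rewrite /cov_deltay (cov_dy_vec_x hM oM' M'u cu) add0r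
  -[RHS](sum_delta (fun k => N c i k u)).
by apply: eq_bigr => k _; rewrite (cov_dx_vec_x hM oM' M'u cu).
Qed.

Lemma cov_deltay_vec_y i j : cov_deltay N c u i (vec_y c u j) = (i == j)%:R.
Proof.
rewrite /cov_deltay (cov_dy_vec_y hM oM' M'u cu) big1 ?addr0// => k _.
by rewrite (cov_dx_vec_y hM oM' M'u cu) mulr0.
Qed.

Lemma cov_deltay_vec_delta i j : cov_deltay N c u i (vec_delta N c u j) = 0.
Proof.
rewrite /cov_deltay (cov_dy_vec_delta hM oM' M'u cu).
rewrite (eq_bigr (fun k => N c i k u * (k == j)%:R)).
  by rewrite (sum_delta (fun k => N c i k u)) addNr.
by move=> k _; rewrite (cov_dx_vec_delta hM oM' M'u cu).
Qed.

(** Linearity of J is assumed only at tangent vectors, in the form of one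
    combined identity, so the value at 0 has to be extracted from it. *)
Lemma acs0 : J u 0 = 0.
Proof.
have T0 : tangent_space (A := TM) u 0 := tangent_space0 u.
by have := acs_linear hJ (- 1) M'u T0 T0; rewrite scaler0 addr0 scaleN1r addNr.
Qed.

Lemma acs_vec_x j :
  J u (vec_x c u j) = \sum_k N c k j u *: vec_delta N c u k - vec_y c u j.
Proof.
have T_sum (r : seq 'I_m) :
    tangent_space (A := TM) u (\sum_(k <- r) N c k j u *: vec_y c u k).
  exact: (tangent_space_sum_TM hM oM' M'u).
have Jsum (r : seq 'I_m) :
    J u (\sum_(k <- r) N c k j u *: vec_y c u k) =
    \sum_(k <- r) N c k j u *: vec_delta N c u k.
  elim: r => [|k r IH]; first by rewrite !big_nil acs0.
  rewrite !big_cons (acs_linear hJ _ M'u (T_y k)); last exact: T_sum.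
  by rewrite IH (acs_vert hJ k M'u cu).
have -> : vec_x c u j = 1 *: (\sum_k N c k j u *: vec_y c u k) + vec_delta N c u j.
  by rewrite scale1r addrC subrK.
rewrite (acs_linear hJ _ M'u (T_sum _) (T_d j)).
by rewrite Jsum scale1r (acs_delta hJ j M'u cu).
Qed.

Lemma cov_dx_acs_vec_x i j : cov_dx c i (J u (vec_x c u j)) = N c i j u.
Proof.
rewrite acs_vec_x /cov_dx !fctE mxE [X in _ + X]mxE.
rewrite -/(cov_dx c i (vec_y c u j)) (cov_dx_vec_y hM oM' M'u cu) subr0.
rewrite fct_sumE summxE -[RHS](sum_delta (fun k => N c k j u)).
apply: eq_bigr => k _; rewrite mxE -/(cov_dx c i (vec_delta N c u k)).
by rewrite (cov_dx_vec_delta hM oM' M'u cu) eq_sym.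
Qed.

Lemma cov_deltay_acs_vec_x i j :
  cov_deltay N c u i (J u (vec_x c u j)) = - (i == j)%:R.
Proof.
rewrite -cov_deltay_vec_y /cov_deltay.
under eq_bigr do rewrite cov_dx_acs_vec_x.
under [in RHS]eq_bigr do rewrite (cov_dx_vec_y hM oM' M'u cu) mulr0.
rewrite big1_eq addr0 acs_vec_x /cov_dy !fctE mxE [X in _ + X + _ = _]mxE.
rewrite addrAC; apply/eqP; rewrite -subr_eq0 opprK subrK; apply/eqP.
rewrite fct_sumE summxE -big_split /=; apply: big1 => k _.
rewrite mxE -/(cov_dy c i (vec_delta N c u k)) (cov_dy_vec_delta hM oM' M'u cu).
by rewrite mulrN mulrC addNr.
Qed.

Notation g i j := (fmetric F c i j u).
Notation w a b := (form2_comp (A := TM) (fundamental_form J G) c a b u).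

Lemma form_yy i j : w (rshift m i) (rshift m j) = 0.
Proof.
rewrite /form2_comp /fundamental_form -/(vec_y c u i) -/(vec_y c u j).
rewrite (acs_vert hJ j M'u cu) (hG M'u cu (T_y i) (T_d j)).
rewrite big1 => [|k _]; last first.
  by rewrite big1// => l _; rewrite (cov_dx_vec_y hM oM' M'u cu) mulr0 mul0r.
rewrite add0r big1// => k _; rewrite big1// => l _.
by rewrite cov_deltay_vec_delta mulr0.
Qed.

Lemma double_sum_delta (h : 'I_m -> 'I_m -> R) (b : 'I_m -> R) i :
  \sum_k \sum_l h k l * (k == i)%:R * b l = \sum_l h i l * b l.
Proof.
rewrite exchange_big; apply: eq_bigr => l _.
rewrite -(sum_delta (fun k => h k l * b l)); apply: eq_bigr => k _.
by rewrite mulrAC.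
Qed.

Lemma form_xy i j : w (lshift m i) (rshift m j) = g i j.
Proof.
rewrite /form2_comp /fundamental_form -/(vec_x c u i) -/(vec_y c u j).
rewrite (acs_vert hJ j M'u cu) (hG M'u cu (T_x i) (T_d j)).
under eq_bigr do under eq_bigr do
  rewrite (cov_dx_vec_x hM oM' M'u cu) (cov_dx_vec_delta hM oM' M'u cu).
rewrite double_sum_delta (sum_delta (fun l => g i l)) big1 ?addr0// => k _.
by rewrite big1// => l _; rewrite cov_deltay_vec_delta mulr0.
Qed.

Lemma form_yx i j : w (rshift m i) (lshift m j) = - g i j.
Proof.
rewrite /form2_comp /fundamental_form -/(vec_y c u i) -/(vec_x c u j).
rewrite (hG M'u cu (T_y i) (acs_bundle_map hJ M'u (T_x j))).
rewrite big1 => [|k _]; last first.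
  by rewrite big1// => l _; rewrite (cov_dx_vec_y hM oM' M'u cu) mulr0 mul0r.
under eq_bigr do under eq_bigr do
  rewrite cov_deltay_vec_y cov_deltay_acs_vec_x.
rewrite double_sum_delta add0r -(sum_delta (fun l => g i l)) -sumrN.
by apply: eq_bigr => l _; rewrite mulrN.
Qed.

Lemma form_xx i j : w (lshift m i) (lshift m j) =
  \sum_k (N c k j u * g k i - N c k i u * g k j).
Proof.
rewrite /form2_comp /fundamental_form -/(vec_x c u i) -/(vec_x c u j).
rewrite (hG M'u cu (T_x i) (acs_bundle_map hJ M'u (T_x j))).
under eq_bigr do under eq_bigr do
  rewrite (cov_dx_vec_x hM oM' M'u cu) cov_dx_acs_vec_x.
rewrite double_sum_delta.
under [X in _ + X]eq_bigr do under eq_bigr do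
  rewrite cov_deltay_vec_x cov_deltay_acs_vec_x.
exact: (contract_xx (fun k l => N c k l u) i j (fmetric_sym hM hF M'u cu)).
Qed.

End FundamentalForm.

(** * Algebraic identities for the exterior derivative *)

Section CurvatureIdentity.
Variables (R : comPzRingType) (n : nat).
Variables (g N : 'I_n -> 'I_n -> R) (Xg Yg XN YN : 'I_n -> 'I_n -> 'I_n -> R).
Hypothesis Yg_sym : forall a h i, Yg a h i = Yg h a i.

(** In this section g i j, N k i stand for the values at a point of g_ij and
    N^k_i, and Xg, Yg, XN, YN for those of their x- and y-derivatives, the
    first index being that of the derivation. This is the left-hand side of
    the first condition of the theorem. *)
Definition metric_defect i j k :=
  Xg j i k - \sum_h N h j * Yg h i k + \sum_h YN i h k * g h j
  - (Xg k i j - \sum_h N h k * Yg h i j + \sum_h YN i h j * g h k).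

(** The curvature R^h_ij of the nonlinear connection. *)
Definition curvature h i j :=
  (XN j h i - \sum_a N a j * YN a h i) - (XN i h j - \sum_a N a i * YN a h j).

(** The derivative along x^a of Phi(x_j, x_k). *)
Definition horizontal_term a j k :=
  \sum_h (N h k * Xg a h j + g h j * XN a h k - (N h j * Xg a h k + g h k * XN a h j)).

(** The component xxy of dPhi.  Exchanging the first two indices of Yg converts
    the derivatives Y_i g_hj of the product rule into the derivatives Y_h g_ij
    that occur in delta_k g_ij. *)
Lemma mixed_exterior_derivative i j k : (forall a h l, Xg a h l = Xg a l h) ->
  Xg j k i - Xg k j i
  + \sum_h (N h k * Yg i h j + g h j * YN i h k
            - (N h j * Yg i h k + g h k * YN i h j)) = metric_defect i j k.
Proof.
move=> Xg_sym; rewrite (Xg_sym j k i) (Xg_sym k j i).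
rewrite (eq_bigr (fun h => N h k * Yg h i j - N h j * Yg h i k
    + (YN i h k * g h j - YN i h j * g h k))).
  by rewrite big_split /= !sumrB /metric_defect; ring.
by move=> h _; rewrite !(Yg_sym i h); ring.
Qed.

(** Substituting d/dx^i = delta_i + N^a_i d/dy^a in each argument of dPhi
    leaves its value on delta_i, delta_j, delta_k, which is the curvature
    expression, and components with one vertical argument; those with two
    vertical arguments vanish. *)
Lemma horizontal_cyclic_sum i j k :
  horizontal_term i j k - horizontal_term j i k + horizontal_term k i j =
  (\sum_h curvature h i j * g h k - \sum_h curvature h i k * g h j
   + \sum_h curvature h j k * g h i)
  + \sum_a (N a i * metric_defect a j k - N a j * metric_defect a i k
            + N a k * metric_defect a i j).
Proof.
(* KS and CS collect the terms linear in N, KD and CD those quadratic in N. *)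
pose KS p q r := \sum_h (XN q h p - XN p h q) * g h r.
pose KD p q r := \sum_a \sum_h (N a p * YN a h q - N a q * YN a h p) * g h r.
pose CS p q r := \sum_a N a p * (Xg q a r - Xg r a q).
pose CD p q r := \sum_a \sum_h N a p * (N h r * Yg h a q - N h q * Yg h a r
                                       + (YN a h r * g h q - YN a h q * g h r)).
have curvE p q r : \sum_h curvature h p q * g h r = KS p q r + KD p q r.
  rewrite /KD exchange_big -big_split; apply: eq_bigr => h _ /=.
  by rewrite -mulr_suml sumrB -mulrDl; congr (_ * _); rewrite /curvature; ring.
have defE p q r : \sum_a N a p * metric_defect a q r = CS p q r + CD p q r.
  rewrite -big_split; apply: eq_bigr => a _ /=.
  rewrite -mulr_sumr -mulrDr big_split /= !sumrB.
  by congr (_ * _); rewrite /metric_defect; ring.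
(* The terms quadratic in N and linear in Yg form the antisymmetrization of Q. *)
pose Q a h := N a j * N h i * Yg h a k + N a i * N h k * Yg h a j
              + N a k * N h j * Yg h a i.
have Q0 : \sum_a \sum_h (Q a h - Q h a) = 0.
  under eq_bigr do rewrite sumrB.
  by rewrite sumrB [X in _ - X]exchange_big subrr.
have single : horizontal_term i j k - horizontal_term j i k + horizontal_term k i j =
    KS i j k - KS i k j + KS j k i + (CS i j k - CS j i k + CS k i j).
  rewrite -!sumrB -!big_split; apply: eq_bigr => h _ /=; ring.
have double : KD i j k - KD i k j + KD j k i + (CD i j k - CD j i k + CD k i j) = 0.
  rewrite -!sumrB -!big_split -[RHS]Q0; apply: eq_bigr => a _ /=.
  rewrite -!sumrB -!big_split; apply: eq_bigr => h _ /=.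
  rewrite /Q !(Yg_sym a h); ring.
rewrite big_split sumrB /= !curvE !defE single -[LHS]addr0 -double; ring.
Qed.

End CurvatureIdentity.

(** * The exterior derivative of the fundamental form *)

Section AlternatingForm.
Context {R : realType} {n : nat} (A : atlas R n).
Hypothesis chart_inj : forall c : chart A, set_inj (dom c) (mcoord c).
Variables (W : set A) (w : form2 A) (c : chart A) (p : A).
Hypotheses (oW : mopen W) (Wp : W p) (cp : dom c p).
Hypothesis w_diff : forall a b, chart_diff c p (form2_comp w c a b).
Hypothesis w_alt : forall q, W q -> dom c q ->
  forall a b, form2_comp w c a b q = - form2_comp w c b a q.

(** An alternating form is alternating at all nearby points, so the relation
    may be differentiated. *)
Lemma pderiv_form2_comp_alt e a b :
  pderiv c e (form2_comp w c a b) p = - pderiv c e (form2_comp w c b a) p.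
Proof.
rewrite -(pderivN chart_inj _ (w_diff b a)).
apply: (pderiv_near chart_inj _ (mopen_chart_nbhs oW Wp cp)) => q Wq cq.
exact: w_alt.
Qed.

Lemma dform2_comp_swap12 a b e : dform2_comp w c a b e p = - dform2_comp w c b a e p.
Proof.
pose d i j k := pderiv c i (form2_comp w c j k) p.
have dE : d e a b = - d e b a := pderiv_form2_comp_alt e a b.
change (d a b e - d b a e + d e a b = - (d b a e - d a b e + d e b a)).
clearbody d; rewrite dE; ring.
Qed.

Lemma dform2_comp_swap23 a b e : dform2_comp w c a b e p = - dform2_comp w c a e b p.
Proof.
pose d i j k := pderiv c i (form2_comp w c j k) p.
have dE : d a b e = - d a e b := pderiv_form2_comp_alt a b e.
change (d a b e - d b a e + d e a b = - (d a e b - d e a b + d b a e)).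
clearbody d; rewrite dE; ring.
Qed.

End AlternatingForm.

Section ExteriorDerivative.
Context {R : realType} {m : nat} (M : atlas R m).
Hypothesis hM : smooth_manifold M.
Notation TM := (tangent_bundle M).
Variables (M' : set TM) (F : TM -> R).
Hypothesis hF : finsler M' F.
Variables (H : TM -> set (tvector TM)) (N : connection_coef M).
Hypotheses (hH : nonlinear_connection M' H) (hN : coef_of M' H N).
Variables (J : TM -> tvector TM -> tvector TM)
  (G : TM -> tvector TM -> tvector TM -> R).
Hypotheses (hJ : associate_acs M' N J) (hG : sasaki_metric M' F N G).
Variables (c : chart M) (u : TM).
Hypotheses (M'u : M' u) (cu : dom c (tproj u)).
Implicit Types i j k : 'I_m.

Let oM' := finsler_open hF.
Notation TMinj := (tangent_bundle_chart_inj hM).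
Notation Phi := (fundamental_form J G : form2 TM).
Notation comp := (@form2_comp _ _ TM Phi c).
Notation D := (@pderiv _ _ TM c).
Notation dPhi a b e := (@dform2_comp _ _ TM Phi c a b e u).

Let N_diff k i : chart_diff (A := TM) c u (N c k i) :=
  connection_coef_diff hM oM' k i hH hN M'u cu.
Let g_diff i j : chart_diff (A := TM) c u (fmetric F c i j) :=
  fmetric_diff hM hF M'u cu i j.
Let nM' : chart_nbhs (A := TM) c M' u := mopen_chart_nbhs oM' M'u cu.

Let near_diff (f h : TM -> R) : (forall q, M' q -> dom c (tproj q) -> f q = h q) ->
  chart_diff (A := TM) c u h -> chart_diff (A := TM) c u f.
Proof.
by move=> fh; apply: (chart_diff_near TMinj nM') => q M'q cq; rewrite fh.
Qed.

Let near_pderiv a (f h : TM -> R) :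
  (forall q, M' q -> dom c (tproj q) -> f q = h q) -> D a f u = D a h u.
Proof. exact: (pderiv_near TMinj _ nM'). Qed.

(** The component Phi(x_i, x_j) as a function on M'. *)
Definition xx_comp i j : TM -> R := fun q =>
  \sum_k (N c k j q * fmetric F c k i q - N c k i q * fmetric F c k j q).

Let xx_term_diff i j k : chart_diff (A := TM) c u
  (fun q => N c k j q * fmetric F c k i q - N c k i q * fmetric F c k j q).
Proof.
apply: (chart_diffD TMinj); last apply: (chart_diffN TMinj);
  exact: (chart_diffM TMinj (N_diff _ _) (g_diff _ _)).
Qed.

Lemma pderiv_xx a i j : D a (comp (lshift m i) (lshift m j)) u =
  \sum_k (N c k j u * D a (fmetric F c k i) u + fmetric F c k i u * D a (N c k j) u
    - (N c k i u * D a (fmetric F c k j) u + fmetric F c k j u * D a (N c k i) u)).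
Proof.
rewrite (near_pderiv a (h := xx_comp i j)); last first.
  by move=> q M'q cq; exact: (form_xx hM hF hJ hG M'q cq i j).
rewrite (pderiv_sum TMinj); last exact: xx_term_diff.
apply: eq_bigr => k _.
have d1 := chart_diffM TMinj (N_diff k j) (g_diff k i).
have d2 := chart_diffM TMinj (N_diff k i) (g_diff k j).
rewrite (pderivD TMinj _ d1 (chart_diffN TMinj d2)) (pderivN TMinj _ d2).
exact: (congr2 (fun s t => s - t) (pderivM TMinj a cu (N_diff k j) (g_diff k i))
  (pderivM TMinj a cu (N_diff k i) (g_diff k j))).
Qed.

Lemma pderiv_xy a i j :
  D a (comp (lshift m i) (rshift m j)) u = D a (fmetric F c i j) u.
Proof. by apply: near_pderiv => q M'q cq; exact: (form_xy hM hF hJ hG M'q cq i j). Qed.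

Lemma pderiv_yy a i j : D a (comp (rshift m i) (rshift m j)) u = 0.
Proof.
rewrite -(pderiv0 TMinj c a u); apply: near_pderiv => q M'q cq.
exact: (form_yy hM hF hJ hG M'q cq i j).
Qed.

Lemma fundamental_form_alt q : M' q -> dom c (tproj q) ->
  forall a b, comp a b q = - comp b a q.
Proof.
move=> M'q cq a b.
have [i ->|i ->] := split_ordP a; have [j ->|j ->] := split_ordP b.
- rewrite !(form_xx hM hF hJ hG M'q cq) -sumrN.
  by apply: eq_bigr => k _; rewrite opprB.
- by rewrite (form_xy hM hF hJ hG M'q cq) (form_yx hM hF hJ hG M'q cq) opprK
    (fmetric_sym hM hF M'q cq).
- by rewrite (form_xy hM hF hJ hG M'q cq) (form_yx hM hF hJ hG M'q cq)
    (fmetric_sym hM hF M'q cq).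
- by rewrite !(form_yy hM hF hJ hG M'q cq) oppr0.
Qed.

Lemma fundamental_form_diff a b : chart_diff (A := TM) c u (comp a b).
Proof.
have [i ->|i ->] := split_ordP a; have [j ->|j ->] := split_ordP b.
- apply: (near_diff (h := xx_comp i j)).
    by move=> q M'q cq; exact: (form_xx hM hF hJ hG M'q cq i j).
  by apply: (chart_diff_sum TMinj) => k; exact: xx_term_diff.
- apply: near_diff (g_diff i j) => q M'q cq.
  exact: (form_xy hM hF hJ hG M'q cq i j).
- apply: near_diff (chart_diffN TMinj (g_diff i j)) => q M'q cq.
  exact: (form_yx hM hF hJ hG M'q cq i j).
- apply: near_diff (chart_diff0 TMinj c u) => q M'q cq.
  exact: (form_yy hM hF hJ hG M'q cq i j).
Qed.

Definition dPhi_swap12 a b e : dPhi a b e = - dPhi b a e :=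
  dform2_comp_swap12 TMinj oM' M'u cu fundamental_form_diff fundamental_form_alt a b e.
Definition dPhi_swap23 a b e : dPhi a b e = - dPhi a e b :=
  dform2_comp_swap23 TMinj oM' M'u cu fundamental_form_diff fundamental_form_alt a b e.

Lemma pderiv_fmetric_sym a i j : D a (fmetric F c i j) u = D a (fmetric F c j i) u.
Proof. by apply: near_pderiv => q M'q cq; exact: (fmetric_sym hM hF M'q cq i j). Qed.

Lemma dPhi_yyy i j k : dPhi (rshift m i) (rshift m j) (rshift m k) = 0.
Proof. by rewrite /dform2_comp !pderiv_yy subrr addr0. Qed.

(** Equality of Y_i g_kj and Y_j g_ki, by the total symmetry of the
    y-derivatives of g. *)
Lemma dPhi_xyy i j k : dPhi (lshift m k) (rshift m i) (rshift m j) = 0.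
Proof.
rewrite /dform2_comp pderiv_yy !pderiv_xy sub0r.
have E : D (rshift m i) (fmetric F c k j) u = D (rshift m j) (fmetric F c k i) u.
  have E : D (rshift m i) (fmetric F c j k) u = D (rshift m j) (fmetric F c i k) u.
    exact: (dy_fmetric hM hF M'u cu i j k).
  exact: (etrans (pderiv_fmetric_sym (rshift m i) k j)
    (etrans E (pderiv_fmetric_sym (rshift m j) i k))).
by apply/eqP; rewrite addrC subr_eq0; apply/eqP; exact: esym E.
Qed.

Let C1 := metric_defect (fun i j => fmetric F c i j u) (fun k i => N c k i u)
  (fun a i j => dx c a (fmetric F c i j) u) (fun a i j => dy c a (fmetric F c i j) u)
  (fun a k i => dy c a (N c k i) u).

Lemma dPhi_xxy i j k : dPhi (lshift m j) (lshift m k) (rshift m i) = C1 i j k.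
Proof.
rewrite /dform2_comp pderiv_xx !pderiv_xy.
apply: mixed_exterior_derivative => [a h l|a h l].
  exact: (dy_fmetric hM hF M'u cu).
exact: pderiv_fmetric_sym.
Qed.

Lemma dPhi_xxx i j k : dPhi (lshift m i) (lshift m j) (lshift m k) =
  \sum_h curv N c h i j u * fmetric F c h k u
  - \sum_h curv N c h i k u * fmetric F c h j u
  + \sum_h curv N c h j k u * fmetric F c h i u
  + \sum_a (N c a i u * C1 a j k - N c a j u * C1 a i k + N c a k u * C1 a i j).
Proof.
rewrite /dform2_comp !pderiv_xx.
exact: (@horizontal_cyclic_sum R m (fun i j => fmetric F c i j u)
  (fun k i => N c k i u) (fun a i j => dx c a (fmetric F c i j) u)
  (fun a i j => dy c a (fmetric F c i j) u) (fun a k i => dx c a (N c k i) u)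
  (fun a k i => dy c a (N c k i) u) (dy_fmetric hM hF M'u cu) i j k).
Qed.

End ExteriorDerivative.

Theorem theorem6 (R : realType) (m : nat) (M : atlas R m)
  (hM : smooth_manifold M)
  (M' : set (tangent_bundle M)) (F : tangent_bundle M -> R)
  (hF : finsler M' F)
  (H : tangent_bundle M -> set (tvector (tangent_bundle M)))
  (hH : nonlinear_connection M' H)
  (N : connection_coef M) (hN : coef_of M' H N)
  (J : tangent_bundle M -> tvector (tangent_bundle M) -> tvector (tangent_bundle M))
  (hJ : associate_acs M' N J)
  (G : tangent_bundle M -> tvector (tangent_bundle M) -> tvector (tangent_bundle M) -> R)
  (hG : sasaki_metric M' F N G) :
  almost_kahler M' J G <->
  (forall (c : chart M) (u : tangent_bundle M), M' u -> dom c (tproj u) ->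
   forall i j k : 'I_m,
     delta N c j (fmetric F c i k) u
       + \sum_h dy c i (N c h k) u * fmetric F c h j u
       - (delta N c k (fmetric F c i j) u
          + \sum_h dy c i (N c h j) u * fmetric F c h k u) = 0
     /\
     \sum_h curv N c h i j u * fmetric F c h k u
       - \sum_h curv N c h i k u * fmetric F c h j u
       + \sum_h curv N c h j k u * fmetric F c h i u = 0).
Proof.
split=> [closed c u M'u cu|cond c u M'u cu].
  have xxy0 i j k := etrans (esym (dPhi_xxy hM hF hH hN hJ hG M'u cu i j k))
    (closed c u M'u cu _ _ _).
  move=> i j k; split; first exact: xxy0.
  have := closed c u M'u cu (lshift m i) (lshift m j) (lshift m k).
  rewrite (dPhi_xxx hM hF hH hN hJ hG M'u cu) [X in _ + X]big1 ?addr0//.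
  by move=> a _; rewrite !xxy0 !mulr0 subrr addr0.
have xxy0 i j k : dform2_comp (fundamental_form J G) c
    (lshift m j) (lshift m k) (rshift m i) u = 0.
  by rewrite (dPhi_xxy hM hF hH hN hJ hG M'u cu); have [] := cond c u M'u cu i j k.
have swap12 := dPhi_swap12 hM hF hH hN hJ hG M'u cu.
have swap23 := dPhi_swap23 hM hF hH hN hJ hG M'u cu.
move=> a b e.
have [i ->|i ->] := split_ordP a; have [j ->|j ->] := split_ordP b;
  have [k ->|k ->] := split_ordP e.
- rewrite (dPhi_xxx hM hF hH hN hJ hG M'u cu).
  have [_ ->] := cond c u M'u cu i j k.
  rewrite add0r big1// => l _.
  by rewrite -!(dPhi_xxy hM hF hH hN hJ hG M'u cu) !xxy0 !mulr0 subrr addr0.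
- exact: xxy0.
- by rewrite swap23 xxy0 oppr0.
- exact: (dPhi_xyy hM hF hJ hG M'u cu).
- by rewrite swap12 swap23 xxy0 !oppr0.
- by rewrite swap12 (dPhi_xyy hM hF hJ hG M'u cu) oppr0.
- by rewrite swap23 swap12 (dPhi_xyy hM hF hJ hG M'u cu) !oppr0.
- exact: (dPhi_yyy hM hF hJ hG M'u cu).
Qed.
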